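(* Let $C_{(<,\geq)}(x,y)$ and $C_{(\neq,\geq)}(x,y)$ be the bivariate generating functions of the Catalan words avoiding the ordered pairs of relations $(<,\geq)$ and $(\neq,\geq)$, respectively, where $x$ marks the length and $y$ marks the number of descents. Then $$C_{(<,\geq)}(x,y)=C_{(\neq,\geq)}(x,y)=1+\frac{1}{1-x}\cdot\frac{x}{1-x}=\frac {1-x+x^2}{ \left(1-x \right) ^{2}}.$$
   Context: A Catalan word of length $n$ is a word $w=w_1w_2\cdots w_n$ over the non-negative integers with $w_1=0$ and $0\leq w_i\leq w_{i-1}+1$ for $i=2,\dots,n$; the empty word is the unique Catalan word of length $0$. For relations $X,Y\in\{<,>,\leq,\geq,=,\neq\}$, a word $w$ contains the pattern $(X,Y)$ if there is an index $i\geq 1$ (with $i+2\le n$) such that $w_i\,X\,w_{i+1}$ and $w_{i+1}\,Y\,w_{i+2}$; otherwise $w$ avoids $(X,Y)$. The number of descents $\mathrm{des}(w)$ is the number of indices $i$ with $w_i>w_{i+1}$. The bivariate generating function is $C_{(X,Y)}(x,y)=\sum_{w}x^{|w|}y^{\mathrm{des}(w)}$, the sum being over all Catalan words $w$ (of any length $|w|\geq 0$) avoiding $(X,Y)$. Identities are between formal power series in $x$ with coefficients polynomials in $y$. *)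

(* Defs.v *)
From HB Require Import structures.
From mathcomp Require Import all_boot all_order all_algebra.
From mathcomp Require Import boolp.

Set Implicit Arguments.
Unset Strict Implicit.
Unset Printing Implicit Defensive.

Import GRing.Theory.
Local Open Scope ring_scope.

(* Formal power series in one variable, as coefficient sequences. *)

Record fps (R : Type) := FPS { fpcoef : nat -> R }.

Lemma fpsP (R : Type) (f g : fps R) : fpcoef f =1 fpcoef g <-> f = g.
Proof. by split=> [|-> //]; case: f g => [f] [g] /= /funext ->. Qed.

HB.instance Definition _ (R : Type) := gen_eqMixin (fps R).
HB.instance Definition _ (R : Type) := gen_choiceMixin (fps R).

Definition fps_zero (R : zmodType) : fps R := FPS (fun=> 0).
Definition fps_opp (R : zmodType) (f : fps R) : fps R :=
  FPS (fun n => - fpcoef f n).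
Definition fps_add (R : zmodType) (f g : fps R) : fps R :=
  FPS (fun n => fpcoef f n + fpcoef g n).

Lemma fps_addA (R : zmodType) : associative (@fps_add R).
Proof. by move=> f g h; apply/fpsP => n /=; rewrite addrA. Qed.
Lemma fps_addC (R : zmodType) : commutative (@fps_add R).
Proof. by move=> f g; apply/fpsP => n /=; rewrite addrC. Qed.
Lemma fps_add0 (R : zmodType) : left_id (@fps_zero R) (@fps_add R).
Proof. by move=> f; apply/fpsP => n /=; rewrite add0r. Qed.
Lemma fps_addN (R : zmodType) :
  left_inverse (@fps_zero R) (@fps_opp R) (@fps_add R).
Proof. by move=> f; apply/fpsP => n /=; rewrite addNr. Qed.

HB.instance Definition _ (R : zmodType) := GRing.isZmodule.Build (fps R)
  (@fps_addA R) (@fps_addC R) (@fps_add0 R) (@fps_addN R).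

Definition fps_one (R : nzRingType) : fps R := FPS (fun n => (n == 0%N)%:R).
Definition fps_mul (R : nzRingType) (f g : fps R) : fps R :=
  FPS (fun n => \sum_(i < n.+1) fpcoef f i * fpcoef g (n - i)%N).
Definition fps_X (R : nzRingType) : fps R := FPS (fun n => (n == 1%N)%:R).

Definition fps_trunc (R : nzRingType) (n : nat) (f : fps R) : {poly R} :=
  \poly_(i < n.+1) fpcoef f i.

Lemma fps_mul_trunc (R : nzRingType) (f g : fps R) (m n : nat) :
  (m <= n)%N -> fpcoef (fps_mul f g) m = (fps_trunc n f * fps_trunc n g)`_m.
Proof.
move=> le_mn; rewrite coefM /=; apply: eq_bigr => i _; rewrite !coef_poly !ltnS.
by rewrite (leq_trans (leq_ord i) le_mn) (leq_trans (leq_subr _ _) le_mn).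
Qed.

Lemma fps_mulA (R : nzRingType) : associative (@fps_mul R).
Proof.
move=> f g h; apply/fpsP => n.
transitivity (fps_trunc n f * (fps_trunc n g * fps_trunc n h))`_n.
  rewrite coefM [LHS]/=; apply: eq_bigr => i _.
  rewrite coef_poly ltn_ord; congr (_ * _).
  exact: fps_mul_trunc (leq_subr i n).
rewrite mulrA coefM [RHS]/=; apply: eq_bigr => i _.
rewrite [(fps_trunc n h)`__]coef_poly ltnS leq_subr; congr (_ * _).
exact/esym/fps_mul_trunc/leq_ord.
Qed.

Lemma fps_mulC (R : comNzRingType) : commutative (@fps_mul R).
Proof.
move=> f g; apply/fpsP => n.
by rewrite !(@fps_mul_trunc _ _ _ n n) // mulrC.
Qed.

Lemma fps_mul1 (R : nzRingType) : left_id (@fps_one R) (@fps_mul R).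
Proof.
move=> f; apply/fpsP => n /=.
rewrite big_ord_recl /= mul1r subn0 big1 ?addr0 // => i _.
by rewrite mul0r.
Qed.

Lemma fps_mulDl (R : nzRingType) :
  left_distributive (@fps_mul R) (@fps_add R).
Proof.
move=> f g h; apply/fpsP => n /=; rewrite -big_split /=.
by apply: eq_bigr => i _; rewrite mulrDl.
Qed.

Lemma fps_one_neq0 (R : nzRingType) : @fps_one R != 0.
Proof.
by apply/eqP => /fpsP /(_ 0%N) /= /eqP; rewrite oner_eq0.
Qed.

HB.instance Definition _ (R : comNzRingType) :=
  GRing.Zmodule_isComNzRing.Build (fps R) (@fps_mulA R) (@fps_mulC R)
    (@fps_mul1 R) (@fps_mulDl R) (@fps_one_neq0 R).

(* A series is invertible iff its constant coefficient is, and then the       *)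
(* coefficients of its inverse g are given by g_0 = 1 / f_0 and               *)
(* g_n = - (\sum_(i < n) g_i f_(n - i)) / f_0; [fps_inv_seq f n] lists the    *)
(* first n of them.                                                           *)
Fixpoint fps_inv_seq (R : comUnitRingType) (f : fps R) (n : nat) : seq R :=
  if n is m.+1 then
    let s := fps_inv_seq f m in
    rcons s ((fpcoef f 0)^-1 *
      ((m == 0%N)%:R - \sum_(i < m) s`_i * fpcoef f (m - i)%N))
  else [::].

Definition fps_unit (R : comUnitRingType) : {pred fps R} :=
  fun f => fpcoef f 0 \is a GRing.unit.

Definition fps_inv (R : comUnitRingType) (f : fps R) : fps R :=
  if f \in @fps_unit R then FPS (fun n => (fps_inv_seq f n.+1)`_n) else f.

Lemma size_fps_inv_seq (R : comUnitRingType) (f : fps R) n :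
  size (fps_inv_seq f n) = n.
Proof. by elim: n => //= n IHn; rewrite size_rcons IHn. Qed.

Lemma nth_fps_inv_seq (R : comUnitRingType) (f : fps R) n i :
  (i < n)%N -> (fps_inv_seq f n)`_i = (fps_inv_seq f i.+1)`_i.
Proof.
elim: n => // n IHn; rewrite ltnS leq_eqVlt => /predU1P[-> //|lt_in].
by rewrite -IHn //= nth_rcons size_fps_inv_seq lt_in.
Qed.

Lemma fps_mulV (R : comUnitRingType) :
  {in @fps_unit R, left_inverse 1 (@fps_inv R) *%R}.
Proof.
move=> f fU; have f0U : fpcoef f 0 \is a GRing.unit by [].
apply/fpsP => n; rewrite /fps_inv fU.
rewrite [LHS]/= big_ord_recr /= subnn nth_rcons size_fps_inv_seq ltnn eqxx.
rewrite mulrC mulVKr //.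
rewrite (eq_bigr (fun i : 'I_n =>
  (fps_inv_seq f n)`_i * fpcoef f (n - i)%N)) => [|i _].
  by rewrite addrC subrK.
by rewrite nth_fps_inv_seq // [(fps_inv_seq f n)`__]nth_fps_inv_seq.
Qed.

Lemma fps_unitPl (R : comUnitRingType) (f g : fps R) :
  g * f = 1 -> @fps_unit R f.
Proof.
move=> /fpsP /(_ 0%N) /=; rewrite big_ord1 /= => gf1.
by apply/unitrPr; exists (fpcoef g 0); rewrite mulrC.
Qed.

Lemma fps_inv_out (R : comUnitRingType) :
  {in [predC @fps_unit R], @fps_inv R =1 id}.
Proof. by move=> f /negbTE fU; rewrite /fps_inv fU. Qed.

HB.instance Definition _ (R : comUnitRingType) :=
  GRing.ComNzRing_hasMulInverse.Build (fps R)
    (@fps_mulV R) (@fps_unitPl R) (@fps_inv_out R).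

Lemma fps_unitE (R : comUnitRingType) (f : fps R) :
  (f \is a GRing.unit) = (fpcoef f 0 \is a GRing.unit).
Proof. by []. Qed.

(* Words are 0-indexed: the letter w_i is [nth 0 w i.-1].                     *)

Local Open Scope nat_scope.

Definition catalan (w : seq nat) : bool :=
  (nth 0 w 0 == 0) &&
  [forall i : 'I_(size w).-1, nth 0 w i.+1 <= (nth 0 w i).+1].

Definition contains (X Y : rel nat) (w : seq nat) : bool :=
  [exists i : 'I_(size w).-2,
     X (nth 0 w i) (nth 0 w i.+1) && Y (nth 0 w i.+1) (nth 0 w i.+2)].

Definition avoids (X Y : rel nat) (w : seq nat) : bool := ~~ contains X Y w.

Definition des (w : seq nat) : nat :=
  #|[set i : 'I_(size w).-1 | nth 0 w i > nth 0 w i.+1]|.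

Definition neqn : rel nat := fun a b => a != b.

Lemma catalan_nth (w : seq nat) i :
  catalan w -> i < size w -> nth 0 w i <= i.
Proof.
case/andP=> /eqP w0 /forallP wS; elim: i => [|i IHi] lt_iw; first by rewrite w0.
have lt_iw1 : i < (size w).-1 by rewrite ltn_predRL.
by apply: leq_trans (wS (Ordinal lt_iw1)) _; rewrite ltnS IHi // ltnW.
Qed.

(* By this lemma, the words of length n in the sum defining [catalan_gf] may  *)
(* be taken with letters in {0, ..., n - 1} without losing any Catalan word.  *)
Lemma catalan_tuple (w : seq nat) :
  catalan w -> exists! t : (size w).-tuple 'I_(size w), map val t = w.
Proof.
move=> wC; have ltw i : i < size w -> nth 0 w i < size w.
  by move=> lt_iw; apply: leq_ltn_trans (catalan_nth wC lt_iw) lt_iw.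
exists [tuple Ordinal (ltw i (ltn_ord i)) | i < size w]; split.
  apply: (@eq_from_nth _ 0) => [|i]; rewrite size_map size_tuple // => lt_iw.
  set t := mktuple _; have -> : i = Ordinal lt_iw by [].
  by rewrite (nth_map (Ordinal lt_iw)) ?size_tuple // -tnth_nth tnth_mktuple.
move=> t tw; apply: val_inj; apply: (inj_map val_inj); rewrite tw.
apply: (@eq_from_nth _ 0) => [|i]; rewrite size_map size_tuple // => lt_iw.
set u := mktuple _; have -> : i = Ordinal lt_iw by [].
by rewrite (nth_map (Ordinal lt_iw)) ?size_tuple // -tnth_nth tnth_mktuple.
Qed.

Local Open Scope ring_scope.

(* C_(X,Y)(x, y), with y the variable of the coefficient ring {poly int}.     *)
Definition catalan_gf (X Y : rel nat) : fps {poly int} :=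
  FPS (fun n =>
    \sum_(w : n.-tuple 'I_n |
            catalan (map val w) && avoids X Y (map val w))
      'X^(des (map val w))).

(* Main.v *)
Require Import Defs.
From mathcomp Require Import all_boot all_order all_algebra.
From mathcomp Require Import zify ring.

Import GRing.Theory.
Local Open Scope ring_scope.

(** In a Catalan word avoiding (<,>=) the first ascent forces all later steps
    to be ascents, while before it the word is constantly 0; hence the word is
    a truncated shift 0, ..., 0, 1, 2, ..., determined by the position of its
    last 0.  Such words have no descent and also avoid (<>,>=), so both series
    are [1 + \sum_n n x^n]. *)

Definition ramp (k n : nat) : seq nat := mkseq (subn^~ k) n.

Lemma catalan_ramp k n : catalan (ramp k n).
Proof.
apply/andP; split; first by case: n => // n; rewrite nth_mkseq.
apply/forallP => -[i]; rewrite /= size_mkseq => lt_in.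
by rewrite !nth_mkseq; lia.
Qed.

(** A weak descent from position [i.+1] to [i.+2] can only occur in the initial block of zeros, so
    the letters at [i] and [i.+1] are both 0 and irreflexivity rules out [X]. *)
Lemma avoids_ramp (X : rel nat) k n :
  irreflexive X -> avoids X geq (ramp k n).
Proof.
move=> Xirr; apply/existsPn => -[i]; rewrite /= size_mkseq => lt_in.
rewrite !nth_mkseq; try lia.
apply/negP => /andP[Xi le_i]; have e : (i - k = i.+1 - k)%N by lia.
by rewrite e Xirr in Xi.
Qed.

Lemma des_ramp k n : des (ramp k n) = 0%N.
Proof.
apply/eqP; rewrite cards_eq0; apply/eqP; apply/setP => -[i lt_in].
rewrite !inE /=; rewrite size_mkseq in lt_in.
by rewrite !nth_mkseq; lia.
Qed.

Lemma avoids_eq_ramp (X : rel nat) (w : seq nat) :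
    subrel ltn X -> (0 < size w)%N -> catalan w -> avoids X geq w ->
  exists2 k, (k < size w)%N & w = ramp k (size w).
Proof.
move=> ltX w_gt0 /andP[/eqP w0 /forallP wC] /existsPn wX.
(* Induction on prefixes: [k] is the position of the last 0 among the letters up to [m], and [k = m]
   means that no ascent has occurred yet. *)
suff H m : (m < size w)%N -> exists2 k, (k <= m)%N &
    forall i, (i <= m)%N -> nth 0%N w i = (i - k)%N.
  case: (H (size w).-1) => [|k le_k wk]; first lia.
  exists k; first lia.
  apply: (@eq_from_nth _ 0%N) => [|i lt_i]; first by rewrite size_mkseq.
  by rewrite nth_mkseq // wk //; lia.
elim: m => [|m IHm] lt_m; first by exists 0%N => // -[].
have [k le_km wk] := IHm (ltnW lt_m).
have lt_m1 : (m < (size w).-1)%N by lia.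
have /= := wC (Ordinal lt_m1); rewrite (wk m) // => le_wm.
have extend k' : (k' <= m.+1)%N ->
    (forall i, (i <= m)%N -> (i - k)%N = (i - k')%N) ->
    nth 0%N w m.+1 = (m.+1 - k')%N ->
  exists2 l, (l <= m.+1)%N &
    forall i, (i <= m.+1)%N -> nth 0%N w i = (i - l)%N.
  move=> le_k' eq_k' wm; exists k' => // i; rewrite leq_eqVlt.
  by case/predU1P=> [-> //|lt_i]; rewrite wk ?eq_k'.
(* An all-zero prefix continues with 0, which moves the last zero to [m.+1], or with 1, which keeps
   [k]. *)
move: le_km; rewrite leq_eqVlt => /predU1P[eq_km|lt_km].
  case w_m: (nth 0%N w m.+1) => [|a].
    by apply: (extend m.+1) => [|i|]; lia.
  by apply: (extend k) => [|i|]; lia.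
(* Here the prefix ends with an ascent, so avoidance makes the next step an ascent too, and the
   Catalan bound makes it equal to 1. *)
case: m {IHm extend} (extend) => [//|m] extend in lt_m lt_m1 wk le_wm lt_km *.
have lt_m2 : (m < (size w).-2)%N by lia.
have /= := wX (Ordinal lt_m2); rewrite (wk m) ?(wk m.+1); try lia.
rewrite ltX /=; last by lia.
by move=> lt_wm; apply: (extend k); lia.
Qed.

Lemma ltn_sub_ord n (k i : 'I_n) : (i - k < n)%N.
Proof. exact: leq_ltn_trans (leq_subr k i) (ltn_ord i). Qed.

Definition ramp_tuple n (k : 'I_n) : n.-tuple 'I_n :=
  [tuple Ordinal (ltn_sub_ord n k i) | i < n].

Lemma val_ramp_tuple n (k : 'I_n) : map val (ramp_tuple n k) = ramp k n.
Proof.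
apply: (@eq_from_nth _ 0%N) => [|i]; rewrite size_map size_tuple.
  by rewrite size_mkseq.
move=> lt_in; rewrite nth_mkseq // (nth_map k) ?size_tuple //.
by rewrite -[i]/(val (Ordinal lt_in)) -tnth_nth tnth_mktuple.
Qed.

Lemma ramp_tuple_inj n : injective (ramp_tuple n).
Proof.
move=> k l eq_kl; apply: val_inj => /=.
(* As [k < n], nothing is truncated in the last letter [n.-1 - k], which therefore determines
   [k]. *)
have /(congr1 (fun s => nth 0%N s n.-1)) :
  ramp k n = ramp l n by rewrite -!val_ramp_tuple eq_kl.
have lt_k := ltn_ord k; have lt_l := ltn_ord l.
by rewrite !nth_mkseq; lia.
Qed.

Definition nat_fps : fps {poly int} := FPS (fun n => n%:R).

(** The two hypotheses cover [<] and [<>] at once: containing [<] makes every nonempty avoider a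
    ramp, and irreflexivity makes every ramp an avoider. *)
Lemma catalan_gf_ramp (X : rel nat) :
  subrel ltn X -> irreflexive X -> catalan_gf X geq = 1 + nat_fps.
Proof.
move=> ltX Xirr; apply/fpsP => -[|n] /=.
  (* Length 0 is separate: [ramp_tuple] has an empty domain there, and the empty word accounts for
     the summand 1. *)
  rewrite addr0 (big_pred1 [tuple]) => [|w].
    by rewrite /des eq_card0 // => -[].
  rewrite tuple0 [RHS]eqxx; apply/andP; split; first exact: (catalan_ramp 0 0).
  exact: (avoids_ramp X 0 0).
rewrite add0r.
have eq_ramp (w : n.+1.-tuple 'I_n.+1) :
    catalan (map val w) && avoids X geq (map val w)
    = (w \in codom (ramp_tuple n.+1)).
  apply/andP/codomP => [[wC wX]|[k ->]]; last first.
    by rewrite val_ramp_tuple catalan_ramp avoids_ramp.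
  case: (avoids_eq_ramp X (map val w)) => //; rewrite size_map size_tuple //.
  move=> k lt_k w_k; exists (Ordinal lt_k).
  by apply/val_inj/(inj_map val_inj); rewrite w_k val_ramp_tuple.
rewrite (eq_bigl _ _ eq_ramp) (eq_bigr (fun=> 1)) => [|_ /codomP[k ->]].
  by rewrite sumr_const card_codom ?card_ord //; apply: ramp_tuple_inj.
by rewrite val_ramp_tuple des_ramp.
Qed.

Lemma coef_fps_XM (R : nzRingType) (f : fps R) n :
  fpcoef (fps_mul (fps_X R) f) n = if n is m.+1 then fpcoef f m else 0.
Proof.
case: n => [|n] /=; first by rewrite big_ord1 mul0r.
rewrite !big_ord_recl /= mul0r add0r mul1r subn1 big1 ?addr0 // => i _.
by rewrite mul0r.
Qed.

Lemma coef_fps_1BXM (R : comNzRingType) (f : fps R) n :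
  fpcoef ((1 - fps_X R) * f) n =
  fpcoef f n - (if n is m.+1 then fpcoef f m else 0).
Proof. by rewrite mulrBl mul1r -coef_fps_XM. Qed.

Lemma fps_geom (R : comNzRingType) : (1 - fps_X R) * FPS (fun=> 1) = 1.
Proof.
by apply/fpsP => -[|n]; rewrite coef_fps_1BXM /= ?subr0 ?subrr.
Qed.

(** Multiplying by [1 - x] takes successive differences of coefficients, here 0 followed by ones,
    which is [x / (1 - x)] by [fps_geom]. *)
Lemma nat_fpsE : (1 - fps_X {poly int}) * nat_fps = fps_X _ * FPS (fun=> 1).
Proof.
apply/fpsP => n; rewrite coef_fps_1BXM [RHS]coef_fps_XM.
by case: n => [|n] /=; rewrite ?subr0 // -natrB ?subSnn.
Qed.

Theorem theorem3p35 :
  let x : fps {poly int} := fps_X {poly int} in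
  [/\ catalan_gf ltn geq = catalan_gf neqn geq,
      catalan_gf neqn geq = 1 + 1 / (1 - x) * (x / (1 - x))
    & 1 + 1 / (1 - x) * (x / (1 - x)) = (1 - x + x ^+ 2) / (1 - x) ^+ 2].
Proof.
move=> x.
have xV : (1 - x)^-1 = FPS (fun=> 1).
  by apply: mulr1_eq; apply: fps_geom.
have xU : 1 - x \is a GRing.unit.
  by apply/unitrPr; exists (FPS (fun=> 1)); apply: fps_geom.
have gf_neq : catalan_gf neqn geq = 1 + nat_fps.
  apply: catalan_gf_ramp => [a b /= lt_ab|a]; rewrite /neqn ?eqxx //.
  by rewrite neq_ltn lt_ab.
split.
- by rewrite gf_neq catalan_gf_ramp // => a; apply: ltnn.
- by rewrite gf_neq xV -nat_fpsE -xV mulrA div1r mulVr // mul1r.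
(* Clearing the invertible denominator leaves the polynomial identity
   [(1 - x) * (1 - x) + x = 1 - x + x ^+ 2]. *)
apply: (mulIr (unitrX 2 xU)); rewrite divrK ?unitrX //.
by rewrite mulrDl mul1r div1r expr2 mulrACA mulVr // divrK // mul1r; ring.
Qed.
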